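(* For any pre-permuton $\mu$, the pair of sequences $$\widetilde{\mathrm{sh}}(\mu)=\Big(\big(\widetilde{\mathrm{LIS}}_k(\mu)-\widetilde{\mathrm{LIS}}_{k-1}(\mu)\big)_{k\in\mathbb{N}^*},\big(\widetilde{\mathrm{LDS}}_k(\mu)-\widetilde{\mathrm{LDS}}_{k-1}(\mu)\big)_{k\in\mathbb{N}^*}\Big)$$ belongs to the Thoma simplex $$\Omega:=\Big\{\big((\alpha_1\ge\alpha_2\ge\dots\ge0),(\beta_1\ge\beta_2\ge\dots\ge0)\big)\ :\ \sum_{i\ge1}\alpha_i+\sum_{j\ge1}\beta_j\le1\Big\}.$$
   Context: $\mathbb{N}^*=\{1,2,\dots\}$. A pre-permuton is a Borel probability measure on $[0,1]^2$ whose two marginals have no atoms. A subset $A\subset[0,1]^2$ is nondecreasing (resp. nonincreasing) if for all $(x_1,y_1),(x_2,y_2)\in A$, $(x_2-x_1)(y_2-y_1)\ge 0$ (resp. $\le 0$). It is $k$-nondecreasing (resp. $k$-nonincreasing) if it is a union of $k$ nondecreasing (resp. nonincreasing) subsets. For $k\in\mathbb{N}^*$, $\widetilde{\mathrm{LIS}}_k(\mu):=\sup_A \mu(A)$ over closed $k$-nondecreasing $A\subset[0,1]^2$, and $\widetilde{\mathrm{LDS}}_k(\mu):=\sup_A\mu(A)$ over closed $k$-nonincreasing $A\subset[0,1]^2$; $\widetilde{\mathrm{LIS}}_0(\mu)=\widetilde{\mathrm{LDS}}_0(\mu):=0$. *)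

(* Defs.v *)
From HB Require Import structures.
From mathcomp Require Import all_boot all_order all_algebra.
From mathcomp Require Import all_classical all_reals all_analysis.

Set Implicit Arguments.
Unset Strict Implicit.
Unset Printing Implicit Defensive.

Import Order.TTheory GRing.Theory Num.Theory.
Import numFieldNormedType.Exports.

Local Open Scope classical_set_scope.
Local Open Scope ring_scope.

Definition unit_square (R : realType) : set (R * R) := `[0, 1] `*` `[0, 1].
Arguments unit_square : clear implicits.

(* A Borel measure on [0,1]^2 is identified with the measure it induces on R^2,
   whose product sigma-algebra is the Borel one; it then gives full mass to the
   unit square. *)
Definition prepermuton (R : realType) (mu : probability (R * R)%type R) : Prop :=
  [/\ mu (unit_square R) = 1%E,
      forall x : R, pushforward mu fst [set x] = 0%E &
      forall y : R, pushforward mu snd [set y] = 0%E].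

Definition nondecreasing_subset (R : realType) (A : set (R * R)) : Prop :=
  A `<=` unit_square R /\
  forall p q, A p -> A q -> 0 <= (q.1 - p.1) * (q.2 - p.2).

Definition nonincreasing_subset (R : realType) (A : set (R * R)) : Prop :=
  A `<=` unit_square R /\
  forall p q, A p -> A q -> (q.1 - p.1) * (q.2 - p.2) <= 0.

Definition k_nondecreasing (R : realType) (k : nat) (A : set (R * R)) : Prop :=
  exists2 F : 'I_k -> set (R * R),
    forall i, nondecreasing_subset (F i) & A = \bigcup_i F i.

Definition k_nonincreasing (R : realType) (k : nat) (A : set (R * R)) : Prop :=
  exists2 F : 'I_k -> set (R * R),
    forall i, nonincreasing_subset (F i) & A = \bigcup_i F i.

(* The suprema are finite, being those of nonempty sets of masses in [0, 1], so
   [fine] loses nothing. *)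
Definition LIS (R : realType) (mu : probability (R * R)%type R) (k : nat) : R :=
  if k is 0%N then 0
  else fine (ereal_sup [set mu A | A in [set A | closed A /\ k_nondecreasing k A]]).

Definition LDS (R : realType) (mu : probability (R * R)%type R) (k : nat) : R :=
  if k is 0%N then 0
  else fine (ereal_sup [set mu A | A in [set A | closed A /\ k_nonincreasing k A]]).

(* Sequences indexed by the positive integers are shifted to start at 0: the
   value at [k] is the term of index [k.+1]. *)
Definition prepermuton_shape (R : realType) (mu : probability (R * R)%type R) :
    (nat -> R) * (nat -> R) :=
  (fun k => LIS mu k.+1 - LIS mu k, fun k => LDS mu k.+1 - LDS mu k).

Definition Thoma_simplex (R : realType) : set ((nat -> R) * (nat -> R)) :=
  [set ab | [/\ nonincreasing_seq ab.1 /\ (forall i, 0 <= ab.1 i),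
                nonincreasing_seq ab.2 /\ (forall j, 0 <= ab.2 j) &
                (\sum_(0 <= i <oo) (ab.1 i)%:E +
                 \sum_(0 <= j <oo) (ab.2 j)%:E <= 1)%E]].
Arguments Thoma_simplex : clear implicits.

(* Main.v *)
(** In the coordinates [(x + y, y - x)] a nondecreasing set is part of the graph
    of a 1-Lipschitz function, and in [(y - x, x + y)] so is a nonincreasing one.
    Monotonicity of the shape: if [A] is covered by [k+2] such graphs and [B] by
    [k], sorting the [2k+2] functions pointwise and separating even from odd
    ranks gives [C] and [D], each covered by [k+1] graphs, with
    [1_A + 1_B <= 1_C + 1_D].  Summability: a nondecreasing and a nonincreasing
    set meet inside one horizontal or vertical line, which is null, so
    [LIS_n + LDS_m <= 1]. *)
Require Import Defs.
From mathcomp Require Import all_boot all_order all_algebra.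
From mathcomp Require Import all_classical all_reals all_analysis.
From mathcomp Require Import lra.

Set Implicit Arguments.
Unset Strict Implicit.
Unset Printing Implicit Defensive.

Import Order.TTheory GRing.Theory Num.Theory.
Import numFieldNormedType.Exports.

Local Open Scope classical_set_scope.
Local Open Scope ring_scope.

(** * Borel measurability in the plane *)

Lemma open_measurable_prod (R : realType) (U : set (R * R)) :
  open U -> measurable U.
Proof.
move=> oU.
(* The boxes with rational centre and radius [1 / (n + 1)] form a countable family; those contained
   in [U] cover it. *)
pose box (w : rat * rat * nat) : set (R * R) :=
  ball (ratr w.1.1 : R) w.2.+1%:R^-1 `*` ball (ratr w.1.2 : R) w.2.+1%:R^-1.
have -> : U = \bigcup_w (if `[< box w `<=` U >] then box w else set0).
  apply/seteqP; split => [p Up|p [w _]]; last first.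
    by case: asboolP => // wU /wU.
  have /nbhs_ballP[e /= e0 eU] : nbhs p U by exact: open_nbhs_nbhs.
  (* A point of the box is within [d] of the centre, itself within [d] of [p]; [d < e / 2] keeps the
     box inside the ball of radius [e] around [p]. *)
  have /= [n nP] := ltr_add_invr (y := 0) (x := e / 2) ltac:(lra).
  rewrite add0r in nP.
  set d : R := n.+1%:R^-1 in nP *.
  have d0 : 0 < d by rewrite invr_gt0.
  have [q1 q1P] := @rat_in_itvoo R p.1 (p.1 + d) ltac:(lra).
  have [q2 q2P] := @rat_in_itvoo R p.2 (p.2 + d) ltac:(lra).
  move: q1P q2P; rewrite !in_itv/= => /andP[a1 b1] /andP[a2 b2].
  exists (q1, q2, n) => //; case: asboolP => [_|].
    by split => /=; rewrite /ball/= ltr_norml -/d; apply/andP; split; lra.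
  case=> z [] /=; rewrite /ball/= !ltr_norml -/d => /andP[c1 d1] /andP[c2 d2].
  apply: eU; split => /=; rewrite /ball/= ltr_norml; apply/andP; split; lra.
apply: countable_bigcupT_measurable => [|w]; first exact: countableP.
by case: ifP => // _; apply: measurableX; exact: measurable_realfun.measurable_ball.
Qed.

Lemma closed_measurable_prod (R : realType) (A : set (R * R)) :
  closed A -> measurable A.
Proof.
move=> cA; rewrite -[A]setCK; apply: measurableC.
by apply: open_measurable_prod; rewrite openC.
Qed.

(** * 1-Lipschitz functions and their extension *)

Definition nonexpansive (R : realType) (f : R -> R) : Prop :=
  forall s t, `|f t - f s| <= `|t - s|.

Lemma nonexpansive_continuous (R : realType) (f : R -> R) :
  nonexpansive f -> continuous f.
Proof.
move=> lf s; apply/cvgrPdist_lt => e e0.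
near=> t; apply: le_lt_trans (lf _ _) _.
by near: t; apply: cvgr_dist_lt.
Unshelve. all: by end_near. Qed.

Lemma nonexpansive_extension (R : realType) (T : Type) (a b : T -> R)
    (F : set T) :
  (forall p q, F p -> F q -> `|b q - b p| <= `|a q - a p|) ->
  exists2 f, nonexpansive f & forall p, F p -> b p = f (a p).
Proof.
move=> ab; have [[p0 Fp0]|F0] := pselect (exists p, F p); last first.
  exists (fun=> 0) => [s t|p Fp]; first by rewrite subrr normr0.
  by case: F0; exists p.
(* McShane extension: the infimum over [F] of the cones [b p + |t - a p|]. A single point [p0] of
   [F] bounds each [E t] below, by the triangle inequality. *)
pose E t := [set b p + `|t - a p| | p in F].
have lbE t : lbound (E t) (b p0 - `|t - a p0|).
  move=> _ [p Fp <-]; have := ab _ _ Fp Fp0.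
  move=> /(le_trans (ler_norm _)); have := ler_distD t (a p0) (a p).
  rewrite [`|a p0 - t|]distrC; lra.
have E0 t : E t !=set0 by exists (b p0 + `|t - a p0|), p0.
have infE t p : F p -> inf (E t) <= b p + `|t - a p|.
  by move=> Fp; apply: ge_inf; [exists (b p0 - `|t - a p0|) | exists p].
have half s t : inf (E t) <= inf (E s) + `|t - s|.
  rewrite -lerBlDr; apply: lb_le_inf => // _ [p Fp <-].
  by have := infE t p Fp; have := ler_distD s t (a p); lra.
exists (fun t => inf (E t)) => [s t|p Fp].
  rewrite ler_norml; apply/andP; split; last by have := half s t; lra.
  by have := half t s; rewrite distrC; lra.
apply/eqP; rewrite eq_le; apply/andP; split.
  apply: lb_le_inf => // _ [q Fq <-]; have := ab _ _ Fq Fp.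
  by move=> /(le_trans (ler_norm _)); lra.
by have := infE (a p) p Fp; rewrite subrr normr0 addr0.
Qed.

(** * Order statistics of a finite family *)

Definition order_stat (R : realType) (s : seq R) (i : nat) : R :=
  nth 0 (sort <=%O s) i.

Lemma order_stat_leP (R : realType) (s : seq R) (v : R) (i : nat) :
  (i < size s)%N -> (order_stat s i <= v) = (i < count (<= v)%O s)%N.
Proof.
move=> si; have srt := sort_le_sorted s.
have cE P : count P s = count P (sort <=%O s).
  by apply/permP; rewrite perm_sym; apply/permPl/perm_sort.
rewrite cE; apply/idP/idP; last exact: nth_count_le.
apply: contraTT; rewrite -leqNgt -ltNge => ci.
by apply: nth_count_gt => //; rewrite ci size_sort.
Qed.

Lemma sub_in_count (T : eqType) (P Q : pred T) (s : seq T) :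
  {in s, forall x, P x -> Q x} -> (count P s <= count Q s)%N.
Proof.
elim: s => //= x s IH PQ; apply: leq_add.
  by have := PQ x (mem_head _ _); case: (P x) => // ->.
by apply: IH => y ys; apply: PQ; rewrite inE ys orbT.
Qed.

(** If [f s <= v] then [f t <= v + |t - s|], so at least as many functions lie below the shifted
    threshold at [t] as below [v] at [s]; [order_stat_leP] turns this count into a bound on the
    order statistic. *)
Lemma order_stat_nonexpansive (R : realType) (fs : seq (R -> R)) (i : nat) :
  (forall f, f \in fs -> nonexpansive f) ->
  nonexpansive (fun t => order_stat [seq f t | f <- fs] i).
Proof.
(* Past the end of the list [nth] returns the default 0, a constant function. *)
move=> lfs; have [si|si] := ltnP i (size fs); last first.
  by move=> s t; rewrite /order_stat !nth_default ?size_sort ?size_map// subrr normr0.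
suff half s t : order_stat [seq f t | f <- fs] i <=
                order_stat [seq f s | f <- fs] i + `|t - s|.
  move=> s t; rewrite ler_norml; apply/andP; split.
    by have := half t s; rewrite distrC; lra.
  by have := half s t; lra.
have := lexx (order_stat [seq f s | f <- fs] i).
rewrite !order_stat_leP ?size_map// => /leq_trans; apply.
rewrite !count_map; apply: sub_in_count => f /lfs lf /=.
by have := lf s t; rewrite ler_norml => /andP[_]; lra.
Qed.

(* A value of multiplicity two occupies two consecutive positions of the sorted
   sequence, hence one of each parity. *)
Lemma order_stat_parity (R : realType) (s : seq R) (v : R) (k : nat) :
  size s = (k.+1).*2 ->
  let even := exists i : 'I_k.+1, v = order_stat s i.*2 in
  let odd := exists i : 'I_k.+1, v = order_stat s (i.*2).+1 in
  (v \in s -> even \/ odd) /\ ((1 < count_mem v s)%N -> even /\ odd).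
Proof.
move=> ss even odd_; have srt := sort_le_sorted s.
have cE P : count P s = count P (sort <=%O s).
  by apply/permP; rewrite perm_sym; apply/permPl/perm_sort.
(* In the sorted sequence the copies of [v] fill exactly the positions [i] with [c <= i < m]. *)
set c := count (< v)%O s; set m := count (<= v)%O s.
have mD : m = (c + count_mem v s)%N.
  rewrite /c /m -count_predUI [X in (_ + X)%N](@eq_count _ _ pred0).
    by rewrite count_pred0 addn0; apply: eq_count => x /=; rewrite le_eqVlt orbC.
  by move=> x /=; case: ltgtP.
have posE i : (c <= i < m)%N -> v = order_stat s i.
  by move=> ci; rewrite /order_stat (@nth_count_eq _ _ v)// -!cE.
have ms : (m <= (k.+1).*2)%N by rewrite -ss count_size.
have evenP i : (c <= i < m)%N -> ~~ odd i -> even.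
  move=> ci oi; have ik : (i./2 < k.+1)%N
    by rewrite ltn_half_double; case/andP: ci => _ /leq_trans; apply.
  by exists (Ordinal ik) => /=; rewrite even_halfK//; exact: posE.
have oddP i : (c <= i < m)%N -> odd i -> odd_.
  move=> ci oi; have ik : (i./2 < k.+1)%N
    by rewrite ltn_half_double; case/andP: ci => _ /leq_trans; apply.
  exists (Ordinal ik) => /=; rewrite odd_halfK// prednK; first exact: posE.
  by case: i oi {ci ik}.
split => [vs|v1].
  have cm : (c <= c < m)%N by rewrite leqnn /= /c /m count_lt_le_mem.
  by case: (boolP (odd c)) => oc; [right; apply: oddP oc|left; apply: evenP oc].
have c0 : (c <= c < m)%N by rewrite leqnn mD -addn1 leq_add2l ltnW.
have c1 : (c <= c.+1 < m)%N by rewrite leqnSn mD -addn2 leq_add2l.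
case: (boolP (odd c)) => oc; split.
- by apply: (evenP c.+1); rewrite //= oc.
- exact: (oddP c).
- exact: (evenP c).
- by apply: (oddP c.+1); rewrite //= oc.
Qed.

(** * Unions of Lipschitz graphs and the exchange argument *)

(** Keeping the coordinates [a] and [b] abstract lets one argument serve both monotonicities:
    exchanging them passes from one to the other. *)
Definition chain (R : realType) (a b : R * R -> R) (F : set (R * R)) : Prop :=
  F `<=` unit_square R /\
  forall p q, F p -> F q -> `|b q - b p| <= `|a q - a p|.

Definition k_chain (R : realType) (a b : R * R -> R) (k : nat)
    (A : set (R * R)) : Prop :=
  exists2 F : 'I_k -> set (R * R),
    forall i, chain a b (F i) & A = \bigcup_i F i.

Lemma k_chain_nonexpansive (R : realType) (a b : R * R -> R) (k : nat)
    (A : set (R * R)) :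
  k_chain a b k A ->
  exists fs : seq (R -> R),
    [/\ size fs = k, forall f, f \in fs -> nonexpansive f &
        forall p, A p -> b p \in [seq f (a p) | f <- fs]].
Proof.
move=> [F cF ->].
have /choice[f fP] i : exists f, nonexpansive f /\ forall p, F i p -> b p = f (a p).
  by have [f ? ?] := nonexpansive_extension (cF i).2; exists f.
exists [seq f i | i <- enum 'I_k]; split.
- by rewrite size_map size_enum_ord.
- by move=> _ /mapP[i _ ->]; exact: (fP i).1.
- move=> p [i _ Fip]; rewrite -map_comp; apply/mapP; exists i.
    by rewrite mem_enum.
  exact: (fP i).2.
Qed.

Definition graph_in_square (R : realType) (a b : R * R -> R) (g : R -> R) :
  set (R * R) := unit_square R `&` [set p | b p = g (a p)].

Lemma chain_graph (R : realType) (a b : R * R -> R) (g : R -> R) :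
  nonexpansive g -> chain a b (graph_in_square a b g).
Proof.
move=> lg; split => [p []//|p q [_ /= ->] [_ /= ->]]; exact: lg.
Qed.

Lemma closed_graph (R : realType) (a b : R * R -> R) (g : R -> R) :
  continuous a -> continuous b -> nonexpansive g ->
  closed (graph_in_square a b g).
Proof.
move=> ca cb lg; apply: closedI.
  have -> : unit_square R = fst @^-1` `[0, 1]%classic `&` snd @^-1` `[0, 1]%classic.
    by [].
  by apply: closedI; apply: preimage_closed => [p _|];
    first [exact: cvg_fst | exact: cvg_snd | exact: interval_closed].
have -> : [set p | b p = g (a p)] = (fun p => b p - g (a p)) @^-1` [set 0].
  by apply/seteqP; split => p /= /eqP; rewrite ?subr_eq0 => /eqP // ->; rewrite subrr.
apply: preimage_closed => [p _|]; last exact: closed_eq.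
apply: cvgB; first exact: cb.
by apply: continuous_comp; [exact: ca|exact: nonexpansive_continuous].
Qed.

(** [C] and [D] are finite unions of closed graphs, so they are themselves admissible in the
    supremum for [k.+1], whatever covers [A] and [B] came with. *)
Lemma chain_exchange (R : realType) (a b : R * R -> R) (k : nat)
    (A B : set (R * R)) :
  continuous a -> continuous b ->
  k_chain a b k.+2 A -> k_chain a b k B ->
  exists C D, [/\ closed C /\ k_chain a b k.+1 C, closed D /\ k_chain a b k.+1 D,
    A `|` B `<=` C `|` D & A `&` B `<=` C `&` D].
Proof.
move=> ca cb kA kB.
have sub_square n E : k_chain a b n E -> E `<=` unit_square R.
  by move=> [F cF ->] p [i _ /(cF i).1].
have sqA := sub_square _ _ kA; have sqB := sub_square _ _ kB.
have [fs [sfs lfs Afs]] := k_chain_nonexpansive kA.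
have [hs [shs lhs Bhs]] := k_chain_nonexpansive kB.
pose g i t := order_stat [seq f t | f <- fs ++ hs] i.
have lg i : nonexpansive (g i).
  apply: order_stat_nonexpansive => f; rewrite mem_cat => /orP[]; [exact: lfs|exact: lhs].
pose U (r : 'I_k.+1 -> nat) := \bigcup_i graph_in_square a b (g (r i)).
have UP r : closed (U r) /\ k_chain a b k.+1 (U r).
  split; last by exists (fun i => graph_in_square a b (g (r i))) => // i; exact: chain_graph.
  by apply: closed_bigcup => [|i _]; [exact: finite_finset|exact: closed_graph].
pose even (i : 'I_k.+1) := i.*2; pose odd (i : 'I_k.+1) := (i.*2).+1.
have size_all p : size [seq f (a p) | f <- fs ++ hs] = (k.+1).*2.
  by rewrite size_map size_cat sfs shs -addnn !addSn addnS.
have inU r p : unit_square R p -> (exists i, b p = g (r i) (a p)) -> U r p.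
  by move=> sp [i ip]; exists i.
exists (U even), (U odd); split => // p.
  move=> ABp; have sp : unit_square R p by case: ABp; [exact: sqA|exact: sqB].
  have [+ _] := order_stat_parity (b p) (size_all p); case.
  - by rewrite map_cat mem_cat; case: ABp => [/Afs ->//|/Bhs ->]; rewrite orbT.
  - by left; exact: inU.
  - by right; exact: inU.
move=> [Ap Bp]; have sp := sqA p Ap.
have [_] := order_stat_parity (b p) (size_all p); case.
  (* A point of both sets has its value [b p] once among the [fs] and once among the [hs], hence
     with multiplicity at least two. *)
  rewrite map_cat count_cat -addn1 (@leq_add 1 1)// -has_count has_pred1.
    exact: Afs.
  exact: Bhs.
by move=> ? ?; split; exact: inU.
Qed.

(** * Maximal masses and their concavity in the number of chains *)

Definition max_mass (R : realType) (mu : probability (R * R)%type R)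
    (P : set (set (R * R))) : R :=
  fine (ereal_sup [set mu A | A in [set A | closed A /\ P A]]).

Lemma closed_fin_num (R : realType) (mu : probability (R * R)%type R)
    (A : set (R * R)) : closed A -> mu A \is a fin_num.
Proof.
by move=> cA; apply: fin_num_measure; exact: closed_measurable_prod.
Qed.

Lemma max_mass_ge (R : realType) (mu : probability (R * R)%type R)
    (P : set (set (R * R))) (A : set (R * R)) :
  closed A -> P A -> fine (mu A) <= max_mass mu P.
Proof.
move=> cA PA; rewrite /max_mass.
set S := [set mu _ | _ in _].
have SA : S (mu A) by exists A.
have leS : (mu A <= ereal_sup S)%E by exact: ereal_sup_ubound.
have S1 : (ereal_sup S <= 1)%E.
  apply: ge_ereal_sup => _ [B [cB _] <-].
  by apply: probability_le1; exact: closed_measurable_prod.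
have S0 : (0 <= ereal_sup S)%E by exact: le_trans (measure_ge0 _ _) leS.
have fS : ereal_sup S \is a fin_num.
  by rewrite ge0_fin_numE//; apply: le_lt_trans S1 _; rewrite ltry.
by apply: fine_le => //; exact: closed_fin_num.
Qed.

Lemma max_mass_le (R : realType) (mu : probability (R * R)%type R)
    (P : set (set (R * R))) (c : R) :
  P set0 -> (forall A, closed A -> P A -> fine (mu A) <= c) ->
  max_mass mu P <= c.
Proof.
move=> P0 Pc; rewrite /max_mass.
set S := [set mu _ | _ in _].
(* The competitor [set0] keeps the supremum away from [-oo], which [fine] would send to 0. *)
have S0 : (0%E <= ereal_sup S)%E.
  apply: ereal_sup_ubound; exists set0; last exact: measure0.
  by split => //; exact: closed0.
have Sc : (ereal_sup S <= c%:E)%E.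
  apply: ge_ereal_sup => _ [B [cB PB] <-].
  by rewrite -(fineK (closed_fin_num mu cB)) lee_fin; exact: Pc.
have fS : ereal_sup S \is a fin_num.
  by rewrite ge0_fin_numE//; apply: le_lt_trans Sc _; rewrite ltry.
by rewrite -lee_fin fineK.
Qed.

Lemma k_chain0 (R : realType) (a b : R * R -> R) (k : nat) :
  k_chain a b k set0.
Proof.
by exists (fun=> set0) => [i|]; [split=> // p []|rewrite bigcup0].
Qed.

Lemma k_chainS (R : realType) (a b : R * R -> R) (k : nat) (A : set (R * R)) :
  k_chain a b k A -> k_chain a b k.+1 A.
Proof.
move=> [F cF ->].
exists (fun i => if unlift ord0 i is Some j then F j else set0).
  by move=> i; case: unliftP => [j _|_]; [exact: cF|split => // p []].
apply/seteqP; split => p [i _].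
  by exists (lift ord0 i) => //; rewrite liftK.
by case: unliftP => // j _ Fjp; exists j.
Qed.

Lemma max_mass_chainS (R : realType) (mu : probability (R * R)%type R)
    (a b : R * R -> R) (k : nat) :
  max_mass mu (k_chain a b k) <= max_mass mu (k_chain a b k.+1).
Proof.
apply: max_mass_le => [|A cA /k_chainS]; first exact: k_chain0.
exact: max_mass_ge.
Qed.

(** This is the decrease of the increments. The exchange gives it through
    [mu X + mu Y = mu (X | Y) + mu (X & Y)], applied to [A], [B] and to [C], [D]. *)
Lemma max_mass_chain_concave (R : realType) (mu : probability (R * R)%type R)
    (a b : R * R -> R) (k : nat) :
  continuous a -> continuous b ->
  max_mass mu (k_chain a b k.+2) + max_mass mu (k_chain a b k) <=
  max_mass mu (k_chain a b k.+1) *+ 2.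
Proof.
(* The two suprema on the left are bounded one after the other, the other term being moved to the
   right each time. *)
move=> ca cb; rewrite -lerBrDr.
apply: max_mass_le => [|A cA kA]; first exact: k_chain0.
rewrite lerBrDl -lerBrDr.
apply: max_mass_le => [|B cB kB]; first exact: k_chain0.
rewrite lerBrDl.
have [C [D [[cC kC] [cD kD] UU II]]] := chain_exchange ca cb kA kB.
have := max_mass_ge mu cC kC; have := max_mass_ge mu cD kD.
suff : fine (mu A) + fine (mu B) <= fine (mu C) + fine (mu D) by lra.
have UI X Y : closed X -> closed Y ->
    fine (mu X) + fine (mu Y) = fine (mu (X `|` Y)) + fine (mu (X `&` Y)).
  move=> cX cY; have fX := closed_fin_num mu cX; have fY := closed_fin_num mu cY.
  have fI := closed_fin_num mu (closedI cX cY).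
  rewrite (measureUfinl (closed_measurable_prod cX) (closed_measurable_prod cY)).
    by rewrite fineB ?fin_numD ?fX// fineD// subrK.
  by rewrite ltey_eq fX.
have mono X Y : closed X -> closed Y -> X `<=` Y -> fine (mu X) <= fine (mu Y).
  move=> cX cY XY; apply: fine_le; [exact: closed_fin_num..|].
  by apply: le_measure; rewrite ?inE//; exact: closed_measurable_prod.
rewrite (UI A B)// (UI C D)//.
by apply: lerD; apply: mono => //; (exact: closedU || exact: closedI).
Qed.

(** * Monotone sets as chains in rotated coordinates *)

Lemma normr_diff_le_sum (R : realType) (x y : R) :
  (`|y - x| <= `|x + y|) = (0 <= x * y).
Proof.
rewrite -ler_sqr ?nnegrE// !real_normK ?num_real// -subr_ge0.
have -> : (x + y) ^+ 2 - (y - x) ^+ 2 = 4 * (x * y).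
  by rewrite subr_sqr; lra.
by rewrite pmulr_rge0.
Qed.

(** For coordinate increments [x] and [y], the Lipschitz condition reads [|y - x| <= |x + y|], which
    after squaring is [0 <= x * y]. *)
Lemma nondecreasing_chain (R : realType) :
  @nondecreasing_subset R = chain (fun p => p.1 + p.2) (fun p => p.2 - p.1).
Proof.
have Ea (p q : R * R) : q.1 + q.2 - (p.1 + p.2) = (q.1 - p.1) + (q.2 - p.2) by lra.
have Eb (p q : R * R) : q.2 - q.1 - (p.2 - p.1) = (q.2 - p.2) - (q.1 - p.1) by lra.
apply/funext => F; apply/propext; split=> -[sF FP]; split => // p q Fp Fq.
  by rewrite Ea Eb normr_diff_le_sum; exact: FP.
by rewrite -normr_diff_le_sum -Ea -Eb; exact: FP.
Qed.

Lemma nonincreasing_chain (R : realType) :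
  @nonincreasing_subset R = chain (fun p => p.2 - p.1) (fun p => p.1 + p.2).
Proof.
(* Replacing [x] by [- x] swaps the sum and the difference up to sign. *)
have E (x y : R) : (x * y <= 0) = (`|x + y| <= `|y - x|).
  by rewrite -oppr_ge0 -mulNr -normr_diff_le_sum opprK addrC [- x + y]addrC.
have Ea (p q : R * R) : q.1 + q.2 - (p.1 + p.2) = (q.1 - p.1) + (q.2 - p.2) by lra.
have Eb (p q : R * R) : q.2 - q.1 - (p.2 - p.1) = (q.2 - p.2) - (q.1 - p.1) by lra.
apply/funext => F; apply/propext; split=> -[sF FP]; split => // p q Fp Fq.
  by rewrite Ea Eb -E; exact: FP.
by rewrite E -Ea -Eb; exact: FP.
Qed.

(** A union over ['I_0] is empty, so the supremum agrees with the convention that [LIS] and [LDS]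
    vanish at 0, and [k = 0] fits the general inequalities. *)
Lemma max_mass_k_chain_0 (R : realType) (mu : probability (R * R)%type R)
    (a b : R * R -> R) : max_mass mu (k_chain a b 0) = 0.
Proof.
apply/eqP; rewrite eq_le; apply/andP; split.
  apply: max_mass_le => [|A _ [F _ ->]]; first exact: k_chain0.
  by rewrite (_ : \bigcup_i F i = set0) ?measure0//; apply/seteqP; split => p [] // [].
by have := max_mass_ge mu closed0 (k_chain0 a b 0); rewrite measure0.
Qed.

Lemma LIS_max_mass (R : realType) (mu : probability (R * R)%type R) (k : nat) :
  LIS mu k = max_mass mu (k_chain (fun p => p.1 + p.2) (fun p => p.2 - p.1) k).
Proof.
case: k => [|k]; first by rewrite max_mass_k_chain_0.
by rewrite /LIS /k_nondecreasing nondecreasing_chain.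
Qed.

Lemma LDS_max_mass (R : realType) (mu : probability (R * R)%type R) (k : nat) :
  LDS mu k = max_mass mu (k_chain (fun p => p.2 - p.1) (fun p => p.1 + p.2) k).
Proof.
case: k => [|k]; first by rewrite max_mass_k_chain_0.
by rewrite /LDS /k_nonincreasing nonincreasing_chain.
Qed.

(** * Disjointness up to null sets of the two kinds of monotone sets *)

Lemma monotone_antitone_line (R : realType) (F G : set (R * R)) :
  nondecreasing_subset F -> nonincreasing_subset G ->
  exists c, F `&` G `<=` fst @^-1` [set c] \/ F `&` G `<=` snd @^-1` [set c].
Proof.
move=> [_ FP] [_ GP].
have FG p q : (F `&` G) p -> (F `&` G) q -> q.1 = p.1 \/ q.2 = p.2.
  move=> [Fp Gp] [Fq Gq].
  have /eqP : (q.1 - p.1) * (q.2 - p.2) = 0.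
    by apply/eqP; rewrite eq_le FP// GP.
  by rewrite mulf_eq0 !subr_eq0 => /orP[] /eqP; [left|right].
have [[p pP]|noP] := pselect (exists p, (F `&` G) p); last first.
  by exists 0; left => p FGp; case: noP; exists p.
(* Any two points of the intersection share a coordinate. If [q] is off the vertical line through
   [p], it has the height of [p]; a third point [r] on that vertical line cannot share the abscissa
   of [q], so it has this height too. *)
have [all1|] := pselect (F `&` G `<=` fst @^-1` [set p.1]).
  by exists p.1; left.
move=> /existsNP[q /not_implyP[qP /= qp1]]; exists p.2; right => r rP /=.
have [//|qp2] := FG _ _ pP qP.
have [rp1|//] := FG _ _ pP rP.
have [rq1|->//] := FG _ _ qP rP.
by case: qp1; rewrite -rq1.
Qed.

Lemma negligible_bigcup_ord (R : realType) (mu : probability (R * R)%type R)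
    (n : nat) (F : 'I_n -> set (R * R)) :
  (forall i, mu.-negligible (F i)) -> mu.-negligible (\bigcup_i F i).
Proof.
move=> nF.
apply: (@negligibleS _ _ _ mu (\bigcup_k if insub k is Some i then F i else set0)).
  by move=> p [i _ Fp]; exists (i : nat) => //; rewrite valK.
apply: negligible_bigcup => k; case: insub => // *; exact: negligible_set0.
Qed.

Lemma LIS_LDS_le1 (R : realType) (mu : probability (R * R)%type R) (n m : nat) :
  prepermuton mu -> LIS mu n + LDS mu m <= 1.
Proof.
move=> [_ mu1 mu2]; rewrite LIS_max_mass LDS_max_mass -lerBrDr.
apply: max_mass_le => [|A cA]; first exact: k_chain0.
rewrite /k_chain -nondecreasing_chain => -[F FP AE]; rewrite lerBrDl -lerBrDr.
apply: max_mass_le => [|B cB]; first exact: k_chain0.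
rewrite /k_chain -nonincreasing_chain => -[G GP BE]; rewrite lerBrDl.
have mA := closed_measurable_prod cA; have mB := closed_measurable_prod cB.
have AB0 : mu (A `&` B) = 0%E.
  apply/negligibleP; first exact: measurableI.
  (* The intersection is a finite union of pieces [F i & G j], each inside a line that is null
     because the marginals have no atoms. *)
  rewrite AE BE setI_bigcupl; apply: negligible_bigcup_ord => i.
  rewrite setI_bigcupr; apply: negligible_bigcup_ord => j.
  have [c [|] FG] := monotone_antitone_line (FP i) (GP j).
    apply: negligibleS FG _; apply/negligibleP; last exact: mu1.
    by rewrite -[X in measurable X]setTI; exact: measurable_fst.
  apply: negligibleS FG _; apply/negligibleP; last exact: mu2.
  by rewrite -[X in measurable X]setTI; exact: measurable_snd.
have fA := closed_fin_num mu cA; have fB := closed_fin_num mu cB.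
rewrite -lee_fin EFinD !fineK//.
have := probability_le1 mu (measurableU _ _ mA mB).
by rewrite measureUfinl ?ltey_eq ?fA// [X in (_ - X)%E]AB0 sube0.
Qed.

(** * Summation of the increments *)

Lemma nneseries_telescope_le (R : realType) (u : nat -> R) (c : R) :
  u 0%N = 0 -> (forall k, u k <= u k.+1) -> (forall k, u k <= c) ->
  (\sum_(0 <= k <oo) (u k.+1 - u k)%:E <= c%:E)%E.
Proof.
move=> u0 u_nd uc; apply: lime_le.
  by apply: is_cvg_nneseries => k _ _; rewrite lee_fin subr_ge0.
by apply: nearW => n; rewrite sumEFin telescope_sumr// u0 subr0 lee_fin.
Qed.

Theorem proposition2p3 (R : realType) (mu : probability (R * R)%type R)
    (hmu : prepermuton mu) :
  Thoma_simplex R (prepermuton_shape mu).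
Proof.
have csum : continuous (fun p : R * R => p.1 + p.2).
  by move=> p; apply: cvgD; [exact: cvg_fst|exact: cvg_snd].
have cdiff : continuous (fun p : R * R => p.2 - p.1).
  by move=> p; apply: cvgB; [exact: cvg_snd|exact: cvg_fst].
have I_nd k : LIS mu k <= LIS mu k.+1.
  by rewrite !LIS_max_mass; exact: max_mass_chainS.
have D_nd k : LDS mu k <= LDS mu k.+1.
  by rewrite !LDS_max_mass; exact: max_mass_chainS.
split.
- split => [|k]; last by rewrite subr_ge0.
  apply/nonincreasing_seqP => k.
  suff : LIS mu k.+2 - LIS mu k.+1 <= LIS mu k.+1 - LIS mu k by [].
  have := max_mass_chain_concave mu k csum cdiff; rewrite -!LIS_max_mass; lra.
- split => [|k]; last by rewrite subr_ge0.
  apply/nonincreasing_seqP => k.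
  suff : LDS mu k.+2 - LDS mu k.+1 <= LDS mu k.+1 - LDS mu k by [].
  have := max_mass_chain_concave mu k cdiff csum; rewrite -!LDS_max_mass; lra.
(* The double bound is summed in two stages: over [k] with [m] fixed here, then over [m] once the
   first series is known to be a real [r]. *)
have Ile m : (\sum_(0 <= k <oo) (LIS mu k.+1 - LIS mu k)%:E <= (1 - LDS mu m)%:E)%E.
  apply: nneseries_telescope_le => // k.
  by have := LIS_LDS_le1 k m hmu; lra.
have : (0 <= \sum_(0 <= k <oo) (LIS mu k.+1 - LIS mu k)%:E)%E.
  by apply: nneseries_ge0 => k _ _; rewrite lee_fin subr_ge0.
(* Nonnegativity excludes [-oo], and the bound at [m = 0] excludes [+oo]. *)
case: (\sum_(0 <= k <oo) _)%E Ile => [r| |] Ile //; last by have := Ile 0%N.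
move=> _; rewrite -leeBrDl// -EFinB.
apply: nneseries_telescope_le => // m.
by have := Ile m; rewrite lee_fin; lra.
Qed.
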